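(* Let $n\ge 2$. Consider repositories with $n$ packages in which all dependencies are known ($U=\emptyset$) and no defects exist ($D=\emptyset$). Any non-adaptive algorithm that solves Full Learning must make at least $n-1$ queries (in the worst case over its inputs). This holds even when the repositories are restricted to have at most one conflict ($|C|\le 1$).
   Context: A repository consists of a finite set $P$ of $n$ packages, a set $K\subseteq P\times P$ of known dependencies, a set $U\subseteq P\times P$ of unknown dependencies, a set $C$ of unknown conflicts (unordered pairs of distinct packages), and a set $D\subseteq P$ of defects. A dependency $(q,p)\in K\cup U$ means that $q$ depends on $p$. The digraph $(P,K)$ is acyclic. An installation is a subset $I\subseteq P$; it is successful iff (i) $I\cap D=\emptyset$, (ii) for every $(q,p)\in K\cup U$, $q\in I$ implies $p\in I$, and (iii) no $\{p,q\}\in C$ satisfies $p,q\in I$. A defect is a package contained in no successful installation, and $D$ is the set of all defects (so every package outside $D$ lies in some successful installation). An algorithm is given $P$, $K$ and the stated bounds. A query is an installation $I\subseteq P$; the oracle answers whether $I$ is successful. A non-adaptive algorithm fixes its whole set of queries from its input alone, then computes its output from the answers. Local computation is free; the cost is the number of queries. Full Learning: output the mixed graph describing the repository (strongly connected components of packages with the defective ones marked, all conflicts, all dependencies). In the present setting (all dependencies known, no defects) this amounts to determining the conflict set $C$ exactly. *)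

(* Defs.v *)
From mathcomp Require Import all_boot.

Set Implicit Arguments.
Unset Strict Implicit.
Unset Printing Implicit Defensive.

(* A pair (q, p) in [known] or [unknown] means that q depends on p.  A conflict
   {p, q} is encoded as the two-element set [set p; q]. *)
Record repository (P : finType) := Repository {
  known : {set P * P};
  unknown : {set P * P};
  conflicts : {set {set P}};
  defects : {set P}
}.

Definition dependencies (P : finType) (R : repository P) : {set P * P} :=
  known R :|: unknown R.

Definition arc (P : finType) (E : {set P * P}) : rel P :=
  fun q p => (q, p) \in E.

(* [cycle] is about closed walks, so this also excludes loops (p, p). *)
Definition acyclic (P : finType) (E : {set P * P}) : Prop :=
  forall c : seq P, cycle (arc E) c -> c = [::].

Definition successful (P : finType) (R : repository P) (I : {set P}) : bool :=
  [&& [disjoint I & defects R],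
      [forall q, forall p,
         ((q, p) \in dependencies R) ==> (q \in I) ==> (p \in I)]
    & [forall p, forall q,
         ([set p; q] \in conflicts R) ==> ~~ ((p \in I) && (q \in I))]].

Definition is_defect (P : finType) (R : repository P) (p : P) : bool :=
  ~~ [exists I : {set P}, successful R I && (p \in I)].

Definition well_formed (P : finType) (R : repository P) : Prop :=
  [/\ acyclic (known R),
      forall c, c \in conflicts R -> #|c| = 2
    & defects R = [set p | is_defect R p]].

Record mixed_graph (P : finType) := MixedGraph {
  components : {set {set P}};
  defective_components : {set {set P}};
  conflict_edges : {set {set P}};
  dependency_arcs : {set P * P}
}.

Definition scc (P : finType) (E : {set P * P}) (p : P) : {set P} :=
  [set q | connect (arc E) p q && connect (arc E) q p].

Definition sccs (P : finType) (E : {set P * P}) : {set {set P}} :=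
  [set scc E p | p : P].

Definition mixed_graph_of (P : finType) (R : repository P) : mixed_graph P :=
  {| components := sccs (dependencies R);
     defective_components :=
       [set X in sccs (dependencies R) | X \subset defects R];
     conflict_edges := conflicts R;
     dependency_arcs := dependencies R |}.

(* [queries] sees only the known dependencies.  [output] sees them again,
   together with the oracle's answers, encoded as the set of those queries that
   were answered "successful". *)
Record nonadaptive_algorithm (P : finType) := NonadaptiveAlgorithm {
  queries : {set P * P} -> {set {set P}};
  output : {set P * P} -> {set {set P}} -> mixed_graph P
}.

Definition answers (P : finType) (A : nonadaptive_algorithm P)
    (R : repository P) : {set {set P}} :=
  [set I in queries A (known R) | successful R I].

(* The class [S] is the promise (the bounds) known to the algorithm. *)
Definition solves_full_learning (P : finType) (S : repository P -> Prop)
    (A : nonadaptive_algorithm P) : Prop :=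
  forall R : repository P, well_formed R -> S R ->
    output A (known R) (answers A R) = mixed_graph_of R.

Definition worst_case_queries_ge (P : finType) (S : repository P -> Prop)
    (A : nonadaptive_algorithm P) (m : nat) : Prop :=
  exists R : repository P,
    [/\ well_formed R, S R & m <= #|queries A (known R)|].

Definition known_deps_no_defects (P : finType) (R : repository P) : Prop :=
  unknown R = set0 /\ defects R = set0.

Definition at_most_one_conflict (P : finType) (R : repository P) : Prop :=
  known_deps_no_defects R /\ #|conflicts R| <= 1.

(* Main.v *)
Require Import Defs.
From mathcomp Require Import all_boot.

Set Implicit Arguments.
Unset Strict Implicit.
Unset Printing Implicit Defensive.

(** Let the known dependencies form a chain p_1 <- p_2 <- ... <- p_(n-1) beside
    an isolated package q, and let q be in conflict with exactly one p_k, or with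
    none.  A query containing q that respects the dependencies is
    {q, p_1, ..., p_j} for some j, and it fails iff k <= j.  Hence the conflict
    {q, p_j} is told apart from {q, p_(j+1)} (from no conflict, if j = n-1) only
    by the query {q, p_1, ..., p_j}, so each of these n-1 sets must be queried. *)

Definition rank (P : finType) (x : P) : nat := enum_rank x.

Lemma rank_inj (P : finType) : injective (@rank P).
Proof. by move=> x y /val_inj /enum_rank_inj. Qed.

Lemma rank_onto (P : finType) (k : nat) : k < #|P| -> exists x : P, rank x = k.
Proof. by move=> lt_k; exists (enum_val (Ordinal lt_k)); rewrite /rank enum_valK. Qed.

(* The element of rank 0 plays the role of the isolated package q. *)
Definition chain_deps (P : finType) : {set P * P} :=
  [set e : P * P | 0 < rank e.2 < rank e.1].

Definition chain_repository (P : finType) (q : P) (X : {set P}) : repository P :=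
  {| known := chain_deps P;
     unknown := set0;
     conflicts := [set [set q; x] | x in X];
     defects := set0 |}.

Definition initial_segment (P : finType) (p : P) : {set P} :=
  [set x | rank x <= rank p].

(** A set with at most one element, empty when [p] has the top rank: conflict with the next package
    and no conflict at all become one case. *)
Definition successors (P : finType) (p : P) : {set P} :=
  [set x | rank x == (rank p).+1].

Definition dependency_closed (P : finType) (I : {set P}) : bool :=
  [forall y, forall x, ((y, x) \in chain_deps P) ==> (y \in I) ==> (x \in I)].

Lemma dependency_closedP (P : finType) (I : {set P}) :
  reflect (forall y x : P, 0 < rank x < rank y -> y \in I -> x \in I)
          (dependency_closed I).
Proof.
apply: (iffP 'forall_forallP) => clI y x.
  move=> lt_xy; apply/implyP; by have := clI y x; rewrite inE /= lt_xy.
by apply/implyP; rewrite inE => /clI clIyx; apply/implyP.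
Qed.

Lemma acyclic_chain_deps (P : finType) : acyclic (chain_deps P).
Proof.
have arc_trans: transitive (Defs.arc (chain_deps P)).
  move=> y x z; rewrite /Defs.arc !inE /= => /andP[_ lt_yx] /andP[-> lt_zy].
  exact: ltn_trans lt_zy lt_yx.
(* For a transitive relation, a cycle relates any two of its members, in particular [x] to
   itself. *)
case=> [//|x c]; rewrite cycle_all2rel // => /allrelP /(_ x x).
by rewrite mem_head /Defs.arc inE /= ltnn andbF => /(_ isT isT).
Qed.

Lemma pair_set_inj (T : finType) (q x y : T) :
  x != q -> [set q; x] = [set q; y] -> x = y.
Proof.
move=> /negbTE neq_xq /setP/(_ x).
by rewrite !inE neq_xq eqxx => /esym/eqP.
Qed.

Lemma successful_chain_repository (P : finType) (q : P) (X I : {set P}) :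
  successful (chain_repository q X) I =
  dependency_closed I && ((q \in I) ==> [disjoint X & I]).
Proof.
rewrite /successful /dependencies /= setU0 disjoint_sym disjoints_subset sub0set /=.
congr (_ && _); apply/'forall_forallP/implyP => [noC qI | disjXI x y].
  rewrite disjoints_subset; apply/subsetP=> x Xx; rewrite inE.
  have /implyP/(_ (imset_f (fun z => [set q; z]) Xx)) := noC q x.
  by rewrite qI.
apply/implyP=> /imsetP[z Xz eq_xy]; apply/negP=> /andP[xI yI].
(* The two pairs agree only as sets, so [x] may be either [q] or [z]; passing through inclusion in
   [I] avoids the case split. *)
have sub_I: [set q; z] \subset I.
  by rewrite -eq_xy; apply/subsetP=> t /set2P[] ->.
have /disjXI/disjointFr/(_ Xz) : q \in I by apply: (subsetP sub_I); rewrite set21.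
by rewrite (subsetP sub_I) ?set22.
Qed.

(** There are no defects: [q] is installable alone, and any other package together with the part of
    the chain below it, since every conflict involves [q]. *)
Lemma well_formed_chain_repository (P : finType) (q : P) (X : {set P}) :
  rank q = 0 -> q \notin X -> well_formed (chain_repository q X).
Proof.
move=> q0 qNX; split; first exact: acyclic_chain_deps.
  move=> c /imsetP[x Xx ->]; rewrite cards2.
  by case: eqP => // eq_qx; rewrite eq_qx Xx in qNX.
apply/esym/setP=> x; rewrite !inE; apply/negbTE; rewrite negbK; apply/existsP.
have [-> | neq_xq] := eqVneq x q.
  exists [set q]; rewrite set11 andbT successful_chain_repository; apply/andP; split.
    by apply/dependency_closedP=> y z /[swap] /set1P->; rewrite q0 ltn0 andbF.
  by apply/implyP=> _; rewrite disjoint_sym disjoints1.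
have x_gt0: 0 < rank x.
  by rewrite lt0n; apply: contra neq_xq => /eqP x0; apply/eqP/rank_inj; rewrite q0.
exists [set y | 0 < rank y <= rank x].
rewrite inE x_gt0 leqnn !andbT successful_chain_repository inE q0 ltnn /= andbT.
apply/dependency_closedP=> y z /andP[z_gt0 lt_zy]; rewrite !inE z_gt0.
by move=> /andP[_]; apply: leq_trans (ltnW lt_zy).
Qed.

Lemma at_most_one_conflict_chain_repository (P : finType) (q : P) (X : {set P}) :
  #|X| <= 1 -> at_most_one_conflict (chain_repository q X).
Proof. by move=> leX1; split=> //=; apply: leq_trans (leq_imset_card _ _) leX1. Qed.

Lemma card_successors (P : finType) (p : P) : #|successors p| <= 1.
Proof.
apply/card_le1P=> x; rewrite inE => /eqP rx y; rewrite !inE -rx.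
by apply/eqP/eqP=> [/rank_inj | ->].
Qed.

(** By closure, a successor of [p] in [I] brings [p] along. So the answers differ only if [I]
    contains [q] and [p] but no successor of [p], which forces [I] to be the initial segment. *)
Lemma successful_successors (P : finType) (q p : P) (I : {set P}) :
    rank q = 0 -> p != q -> I != initial_segment p ->
  successful (chain_repository q [set p]) I =
  successful (chain_repository q (successors p)) I.
Proof.
move=> q0 neq_pq neqI; rewrite !successful_chain_repository.
case: dependency_closedP => //= clI; case qI: (q \in I) => //=.
have p_gt0: 0 < rank p.
  by rewrite lt0n; apply: contra neq_pq => /eqP x0; apply/eqP/rank_inj; rewrite q0.
rewrite disjoints1; apply/idP/idP => [pNI | disjI].
  rewrite disjoints_subset; apply/subsetP=> x; rewrite !inE => /eqP rx.
  by apply: contra pNI; apply: clI; rewrite rx p_gt0 leqnn.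
apply: contra neqI => pI; rewrite eqEsubset; apply/andP; split; apply/subsetP=> x.
  move=> xI; rewrite inE leqNgt; apply/negP=> lt_px.
  (* Ranks have no gaps, so a package [x] of [I] above [p] yields a successor [y] of [p]. It is [x]
     itself or a dependency of [x], hence in [I]. *)
  have [y ry] : exists y : P, rank y = (rank p).+1.
    by apply: rank_onto; apply: leq_ltn_trans lt_px (ltn_ord _).
  have /(disjointFr disjI) /negP : y \in successors p by rewrite inE ry.
  case; move: lt_px; rewrite leq_eqVlt -ry => /predU1P[/rank_inj -> //|lt_yx].
  by apply: clI xI; rewrite lt_yx ry.
rewrite inE leq_eqVlt => /predU1P[/rank_inj -> //|lt_xp].
(* Closure says nothing about rank 0, but that package is [q], which is in [I] by assumption. *)
have [x0 | x_gt0] := posnP (rank x); last by apply: clI pI; rewrite x_gt0.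
by have -> : x = q by apply: rank_inj; rewrite q0.
Qed.

Lemma initial_segment_queried (P : finType) (S : repository P -> Prop)
    (A : nonadaptive_algorithm P) (q p : P) :
    (forall R, at_most_one_conflict R -> S R) -> solves_full_learning S A ->
    rank q = 0 -> p != q ->
  initial_segment p \in queries A (chain_deps P).
Proof.
move=> sub_S solA q0 neq_pq; apply/negPn/negP => notQ.
have qN1: q \notin [set p] by rewrite inE eq_sym.
have qN2: q \notin successors p by rewrite inE q0.
have out1 := solA _ (well_formed_chain_repository q0 qN1)
  (sub_S _ (at_most_one_conflict_chain_repository q (eq_leq (cards1 p)))).
have out2 := solA _ (well_formed_chain_repository q0 qN2)
  (sub_S _ (at_most_one_conflict_chain_repository q (card_successors p))).
have eqA: answers A (chain_repository q [set p]) =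
          answers A (chain_repository q (successors p)).
  apply/setP=> I; rewrite !inE; case QI: (I \in _) => //=.
  by apply: successful_successors => //; apply: contraNneq notQ => <-.
have := congr1 (@conflict_edges P) out1; rewrite eqA {}out2 /= => eqC.
have /imsetP[x] : [set q; p] \in [set [set q; x] | x in successors p].
  by rewrite eqC; apply: (imset_f (fun z => [set q; z])); rewrite set11.
by rewrite inE => /[swap] /(pair_set_inj neq_pq) <-; rewrite ltn_eqF.
Qed.

Lemma initial_segment_inj (P : finType) : injective (@initial_segment P).
Proof.
move=> x y /setP eq_xy; apply/rank_inj/eqP; rewrite eqn_leq.
have := eq_xy x; have := eq_xy y.
by rewrite !inE !leqnn => -> <-.
Qed.

(** Keeping [S] abstract serves both classes of the theorem at once. *)
Lemma full_learning_queries_ge (P : finType) (S : repository P -> Prop)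
    (A : nonadaptive_algorithm P) :
    0 < #|P| -> (forall R, at_most_one_conflict R -> S R) ->
  solves_full_learning S A -> worst_case_queries_ge S A (#|P| - 1).
Proof.
move=> P_gt0 sub_S solA; have [q q0] := rank_onto P_gt0.
(* The queries depend on the known dependencies only, so the conflict-free repository already
   witnesses the bound. *)
exists (chain_repository q set0); split.
- by apply: well_formed_chain_repository; rewrite ?inE.
- by apply/sub_S/at_most_one_conflict_chain_repository; rewrite cards0.
rewrite subn1 -(cardC1 q) -(card_imset (predC1 q) (@initial_segment_inj P)).
apply/subset_leq_card/subsetP=> _ /imsetP[p neq_pq ->].
exact: (initial_segment_queried sub_S solA q0).
Qed.

Theorem theorem7 (n : nat) (hn : 2 <= n) (P : finType) (hP : #|P| = n)
    (A : nonadaptive_algorithm P) :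
  (solves_full_learning (@known_deps_no_defects P) A ->
     worst_case_queries_ge (@known_deps_no_defects P) A (n - 1))
  /\
  (solves_full_learning (@at_most_one_conflict P) A ->
     worst_case_queries_ge (@at_most_one_conflict P) A (n - 1)).
Proof.
have P_gt0: 0 < #|P| by rewrite hP ltnW.
by rewrite -hP; split; apply: full_learning_queries_ge => // R [].
Qed.
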